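(* Let $D_L$ and $D_R$ be discrete power-law (Zipfian) distributions on the positive integers with parameters $(\alpha_L,1,\infty)$ and $(\alpha_R,1,\infty)$, with means $\mu_L=\mathbb{E}[D_L]$, $\mu_R=\mathbb{E}[D_R]$, and suppose $n_L\mu_L=n_R\mu_R$. Consider the following sampler: draw i.i.d. weights $w_u\sim D_L$ for $u\in L=\{1,\dots,n_L\}$ and $w_v\sim D_R$ for $v\in R$ ($|R|=n_R$); for each pair $(a,b)$ of a distinct value $a$ occurring among the left weights and a distinct value $b$ occurring among the right weights, let $V_L=\{u\in L: w_u=a\}$, $V_R=\{v\in R:w_v=b\}$, draw $e\sim\mathrm{Binomial}(|V_L||V_R|,\ ab/(n_R\mu_R))$, and add $e$ edges chosen uniformly without replacement from $V_L\times V_R$. Assuming each binomial draw and each per-pair bookkeeping step costs $O(1)$ time and each edge costs $O(1)$ time to draw and add, the expected running time is $O\!\left(n_L^{1/(\alpha_L-1)}n_R^{1/(\alpha_R-1)}+\mu_Ln_L\right)$. For $\alpha_L,\alpha_R>3$ the second term dominates, so the running time is within a constant factor of the expected number of output edges, hence asymptotically optimal.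
   Context: Discrete power-law (Zipfian) distribution with parameters $(\alpha,1,\infty)$, $\alpha>1$: $\Pr[W=k]\propto k^{-\alpha}$ for integers $k\ge1$. (For $\alpha\le 2$ the mean is infinite; the statement is meaningful when $\mu_L,\mu_R<\infty$.)
   Formalization: The binomial success probability ab/(n_R μ_R) can exceed 1, where the binomial is undefined, so it is replaced by min(1, ab/(n_R μ_R)); the elementary remark that the second term dominates for α_L, α_R > 3 is not stated separately, only the resulting constant-factor bound. *)

(* Defs.v *)
From HB Require Import structures.
From mathcomp Require Import all_boot all_order all_algebra.
From mathcomp Require Import all_classical all_reals all_analysis.
Set Implicit Arguments. Unset Strict Implicit. Unset Printing Implicit Defensive.
Import Order.TTheory GRing.Theory Num.Theory.
Local Open Scope ring_scope.
Local Open Scope classical_set_scope.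

Section Defs.
Variable R : realType.

Definition zipf_norm (a : R) : \bar R :=
  \esum_(k in [set k : nat | (0 < k)%N]) ((k%:R `^ (- a))%:E).

Definition zipf_pmf (a : R) (k : nat) : R :=
  if (0 < k)%N then k%:R `^ (- a) / fine (zipf_norm a) else 0.

Definition zipf_mean (a : R) : \bar R :=
  \esum_(k in [set: nat]) ((k%:R * zipf_pmf a k)%:E).

Definition wprob (a : R) (n : nat) (w : {ffun 'I_n -> nat}) : R :=
  \prod_(i < n) zipf_pmf a (w i).

Definition binom_mean (m : nat) (p : R) : R :=
  \sum_(k < m.+1) k%:R * ('C(m, k)%:R * p ^+ k * (1 - p) ^+ (m - k)).

Definition cls (n : nat) (w : {ffun 'I_n -> nat}) (a : nat) : nat :=
  #|[set i | w i == a]|.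

Definition dvals (n : nat) (w : {ffun 'I_n -> nat}) : seq nat := undup (codom w).

Definition cond_edges (muR : R) (nL nR : nat)
  (wl : {ffun 'I_nL -> nat}) (wr : {ffun 'I_nR -> nat}) : R :=
  \sum_(a <- dvals wl) \sum_(b <- dvals wr)
     binom_mean (cls wl a * cls wr b)
       (Num.min 1 (a%:R * b%:R / (nR%:R * muR))).

(* expected running time conditional on the weights: O(1) per weight drawn,
   O(1) per pair (a,b) of distinct values, O(1) per edge *)
Definition cond_time (muR : R) (nL nR : nat)
  (wl : {ffun 'I_nL -> nat}) (wr : {ffun 'I_nR -> nat}) : R :=
  (nL + nR + size (dvals wl) * size (dvals wr))%:R + cond_edges muR wl wr.

Definition expect_over (aL aR : R) (nL nR : nat)
  (f : {ffun 'I_nL -> nat} -> {ffun 'I_nR -> nat} -> R) : \bar R :=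
  \esum_(w in [set: {ffun 'I_nL -> nat} * {ffun 'I_nR -> nat}])
     ((wprob aL w.1 * wprob aR w.2 * f w.1 w.2)%:E).

Definition expected_time (aL aR : R) (nL nR : nat) : \bar R :=
  expect_over aL aR (@cond_time (fine (zipf_mean aR)) nL nR).

Definition expected_edges (aL aR : R) (nL nR : nat) : \bar R :=
  expect_over aL aR (@cond_edges (fine (zipf_mean aR)) nL nR).

End Defs.

(* Main.v *)
(* Let S_L and S_R be the sums of the left and right weights. The numbers D_L and
   D_R of distinct weights satisfy D_L * D_R <= S_L + S_R, since among distinct
   positive integers at most x are <= x. A binomial of mean at most
   |V_L| |V_R| a b / (n_R mu_R) for each pair gives at most
   S_L S_R / (n_R mu_R) edges on average, conditionally on the weights. Taking
   expectations and using n_L mu_L = n_R mu_R and mu >= 1, the expected running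
   time is at most 5 mu_L n_L, so the first term of the bound is never needed.
   Conversely all weights are at least 1, so there are at least
   n_L n_R / (n_R mu_R) = n_L / mu_R edges on average. *)

Require Import Defs.
From HB Require Import structures.
From mathcomp Require Import all_boot all_order all_algebra.
From mathcomp Require Import all_classical all_reals all_analysis.
From mathcomp Require Import ring lra.
Import Order.TTheory GRing.Theory Num.Theory.
Local Open Scope ring_scope.

(** * Sums of nonnegative families: scaling and products *)

(** Comparing finite subsums gives [<=]; for [c != 0] the same inequality, applied to the scaled
    family with the factor [c^-1], gives the converse. *)
Lemma ge0_esumZl (R : realType) (T : choiceType) (P : set T) (f : T -> \bar R) (c : R) :
  0 <= c -> (forall x, 0 <= f x)%E ->
  (\esum_(x in P) (c%:E * f x) = c%:E * \esum_(x in P) f x)%E.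
Proof.
have le_esumZl (d : R) (g : T -> \bar R) : 0 <= d -> (forall x, 0 <= g x)%E ->
    (\esum_(x in P) (d%:E * g x) <= d%:E * \esum_(x in P) g x)%E.
  move=> d0 g0; apply: ge_ereal_sup => _ [X XP <-].
  rewrite -ge0_mule_fsumr//; apply: lee_wpmul2l; first by rewrite lee_fin.
  by apply: ereal_sup_ubound; exists X.
move=> c0 f0; apply/eqP; rewrite eq_le le_esumZl//=.
have [->|cN0] := eqVneq c 0.
  by rewrite mul0e esum_ge0// => x _; rewrite mul0e.
have cE x : (c^-1%:E * (c%:E * f x) = f x)%E.
  by rewrite muleA -EFinM mulVf// mul1e.
have -> : (\esum_(x in P) f x = \esum_(x in P) (c^-1%:E * (c%:E * f x)))%E.
  by apply: eq_esum => x _; rewrite cE.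
have -> : (\esum_(x in P) (c%:E * f x) =
    c%:E * (c^-1%:E * \esum_(x in P) (c%:E * f x)))%E.
  by rewrite muleA -EFinM mulfV// mul1e.
apply: lee_wpmul2l; first by rewrite lee_fin.
apply: le_esumZl => [|x]; first by rewrite invr_ge0.
by rewrite mule_ge0// lee_fin.
Qed.

(** Tonelli for nonnegative families: sum over the second coordinate first, then pull out the
    constant [t]. *)
Lemma esum_prod (R : realType) (T U : choiceType) (f : T -> R) (g : U -> R) (s t : R) :
  (forall x, 0 <= f x) -> (forall y, 0 <= g y) ->
  (\esum_(x in [set: T]) (f x)%:E = s%:E)%E ->
  (\esum_(y in [set: U]) (g y)%:E = t%:E)%E ->
  (\esum_(w in [set: T * U]) (f w.1 * g w.2)%:E = (s * t)%:E)%E.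
Proof.
move=> f0 g0 fs gt.
have -> : [set: T * U]%classic = ([set: T] `*`` fun=> [set: U])%classic.
  by apply/seteqP; split.
rewrite -(@esum_esum R T U setT (fun=> setT) (fun x y => (f x * g y)%:E)); last first.
  by move=> x y _ _; rewrite lee_fin mulr_ge0.
have t0 : 0 <= t by rewrite -lee_fin -gt esum_ge0// => y _; rewrite lee_fin.
rewrite (eq_esum (b := fun x => (t%:E * (f x)%:E)%E)); last first.
  move=> x _; rewrite (eq_esum (b := fun y => ((f x)%:E * (g y)%:E)%E)).
    by rewrite ge0_esumZl ?gt 1?muleC// => y; rewrite lee_fin.
  by move=> y _; rewrite EFinM.
by rewrite ge0_esumZl ?fs 1?muleC// => x; rewrite lee_fin.
Qed.

(** Distributivity over infinite index sets, by induction on [n]: the bijection [cons] identifies a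
    function on ['I_n.+1] with its value at [ord0] and its tail, and [esum_prod] separates the
    two. *)
Lemma esum_ffun_prod (R : realType) (T : choiceType) (n : nat)
    (g : 'I_n -> T -> R) (s : 'I_n -> R) :
  (forall i x, 0 <= g i x) ->
  (forall i, \esum_(x in [set: T]) (g i x)%:E = (s i)%:E)%E ->
  (\esum_(w in [set: {ffun 'I_n -> T}]) (\prod_(i < n) g i (w i))%:E =
   (\prod_(i < n) s i)%:E)%E.
Proof.
elim: n g s => [|n IHn] g s g0 gs.
  have w0 : {ffun 'I_0 -> T} by apply: finfun => -[].
  have -> : [set: {ffun 'I_0 -> T}]%classic = [set w0]%classic.
    by apply/seteqP; split => // w _ /=; apply/ffunP => -[].
  by rewrite esum_set1 ?big_ord0// lee_fin.
pose cons (p : T * {ffun 'I_n -> T}) : {ffun 'I_n.+1 -> T} :=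
  [ffun i => if unlift ord0 i is Some j then p.2 j else p.1].
pose uncons (w : {ffun 'I_n.+1 -> T}) : T * {ffun 'I_n -> T} :=
  (w ord0, [ffun j => w (lift ord0 j)]).
have cons_bij : set_bij setT setT cons.
  rewrite setTT_bijective; exists uncons => [[x w]|w].
    congr pair; first by rewrite ffunE unlift_none.
    by apply/ffunP => j; rewrite !ffunE liftK.
  by apply/ffunP => i; rewrite !ffunE; case: unliftP => [j|] ->; rewrite ?ffunE.
rewrite (reindex_esum _ _ _ _ cons_bij) big_ord_recl.
rewrite -(@esum_prod R _ _ (g ord0)
  (fun w : {ffun 'I_n -> T} => \prod_(i < n) g (lift ord0 i) (w i))) //; last first.
- exact: (IHn (fun i => g (lift ord0 i)) (fun i => s (lift ord0 i))).
- by move=> w; rewrite prodr_ge0.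
apply: eq_esum => -[x w] _; rewrite big_ord_recl ffunE unlift_none.
by congr (_ * _)%:E; apply: eq_bigr => i _; rewrite ffunE liftK.
Qed.


(** * The Zipf law: normalization and mean *)

(* Condensation: the terms of index [2k] and [2k + 1] are both at most
   [(2k) ^ - a]; iterating this bounds the partial sums by [1 / (1 - 2 ^ (1 - a))]. *)
Lemma sum_powR_double (R : realType) (a : R) (n : nat) : 1 < a ->
  \sum_(0 <= k < n.*2 | (0 < k)%N) k%:R `^ (- a) <=
  1 + 2 `^ (1 - a) * \sum_(0 <= k < n | (0 < k)%N) k%:R `^ (- a) :> R.
Proof.
move=> a1; elim: n => [|n IHn].
  by rewrite double0 !big_geq// mulr0 addr0.
rewrite doubleS !big_mkcond/= 2?big_nat_recr//= -!big_mkcond/=.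
rewrite [in leRHS]big_mkcond/= big_nat_recr//= -big_mkcond/=.
(* The pair of indices 0 and 1 is special: 0 is filtered out, and index 1 accounts for the additive
   1. *)
case: n IHn => [|n] IHn.
  by rewrite /= !big_geq// !addr0 mulr0 add0r addr0 powR1.
rewrite double_gt0 /=.
have even_term : 2 `^ (1 - a) * n.+1%:R `^ (- a) = 2 * n.+1.*2%:R `^ (- a).
  rewrite -muln2 natrM powRM// powRD ?pnatr_eq0 ?implybT// powRr1//; ring.
have odd_term : n.+1.*2.+1%:R `^ (- a) <= n.+1.*2%:R `^ (- a) :> R.
  rewrite !powRN lef_pV2 ?posrE ?powR_gt0 ?ltr0n ?double_gt0//.
  by rewrite ge0_ler_powR ?nnegrE ?ler_nat//; lra.
rewrite mulrDr even_term; lra.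
Qed.

Lemma zipf_norm_fin_num (R : realType) (a : R) : 1 < a -> zipf_norm a \is a fin_num.
Proof.
move=> a1; set q : R := 2 `^ (1 - a).
have q1 : q < 1.
  rewrite /q -opprB powRN invf_lt1 ?powR_gt0//.
  by rewrite -[ltLHS](powRr0 2) /powR pnatr_eq0/= ltr_expR mul0r mulr_gt0 ?ln_gt0 ?ltr1n// subr_gt0.
(* With [S n] the partial sum, [S n <= S n.*2 <= 1 + q * S n]; since [q < 1], this can be solved for
   [S n]. *)
have partial_le n : \sum_(0 <= k < n | (0 < k)%N) k%:R `^ (- a) <= (1 - q)^-1.
  have := sum_powR_double R a n a1; rewrite -/q => double_le.
  have mono : \sum_(0 <= k < n | (0 < k)%N) k%:R `^ (- a) <=
      \sum_(0 <= k < n.*2 | (0 < k)%N) k%:R `^ (- a) :> R.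
    rewrite (@big_cat_nat _ _ _ n _ n.*2)//= -?addnn ?leq_addr// lerDl.
    by rewrite sumr_ge0// => k _; rewrite powR_ge0.
  rewrite -[leRHS]mul1r ler_pdivlMr ?subr_gt0//; lra.
rewrite ge0_fin_numE; last by apply: esum_ge0 => k _; rewrite lee_fin powR_ge0.
rewrite /zipf_norm -nneseries_esum; last by move=> k _; rewrite lee_fin powR_ge0.
apply: (@le_lt_trans _ _ ((1 - q)^-1)%:E); last exact: ltry.
apply: lime_le; first by apply: is_cvg_nneseries => k _ _; rewrite lee_fin powR_ge0.
by apply: nearW => n; rewrite sumEFin lee_fin.
Qed.

Lemma zipf_norm_gt0 (R : realType) (a : R) : 1 < a -> 0 < fine (zipf_norm a).
Proof.
move=> a1; rewrite -lte_fin fineK ?zipf_norm_fin_num//.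
apply: (@lt_le_trans _ _ 1%E) => //; apply: esum_ge.
exists [set 1%N]%classic; first by split => [|k /= ->].
by rewrite fsbig_set1 powR1.
Qed.

Lemma zipf_pmf_ge0 (R : realType) (a : R) k : 1 < a -> 0 <= zipf_pmf a k.
Proof.
move=> a1; rewrite /zipf_pmf; case: ifP => // _.
by rewrite divr_ge0 ?powR_ge0// ltW// zipf_norm_gt0.
Qed.

Lemma zipf_pmf_sum1 (R : realType) (a : R) : 1 < a ->
  (\esum_(k in [set: nat]) (zipf_pmf a k)%:E = 1%:E)%E.
Proof.
move=> a1.
rewrite (eq_esum (b := fun k : nat => ((fine (zipf_norm a))^-1%:E *
  (if k \in [set k : nat | (0 < k)%N]%classic then (k%:R `^ (- a))%:E else 0))%E)).
  rewrite ge0_esumZl ?invr_ge0 ?(ltW (zipf_norm_gt0 _ _ a1))//; last first.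
    by move=> k; case: ifP => // _; rewrite lee_fin powR_ge0.
  rewrite -esum_mkcond -/(zipf_norm a) -[X in (_ * X)%E]fineK ?zipf_norm_fin_num//.
  by rewrite -EFinM mulVf// gt_eqF// zipf_norm_gt0.
move=> k _; rewrite /zipf_pmf.
have -> : (k \in [set k : nat | (0 < k)%N]%classic) = (0 < k)%N.
  by apply/idP/idP; rewrite in_setE.
case: ifP => _; first by rewrite mulrC EFinM.
by rewrite mule0.
Qed.

(** There is no mass at 0, so [k * zipf_pmf a k] dominates [zipf_pmf a k] termwise, and the masses
    sum to 1. *)
Lemma zipf_mean_ge1 (R : realType) (a : R) : 1 < a ->
  zipf_mean a \is a fin_num -> 1 <= fine (zipf_mean a).
Proof.
move=> a1 mean_fin; rewrite -lee_fin fineK// -(zipf_pmf_sum1 R a a1).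
apply: le_esum => -[|k] _; rewrite lee_fin; first by rewrite mul0r.
by rewrite ler_peMl ?zipf_pmf_ge0// ler1n.
Qed.

(** * The joint law of i.i.d. weights *)

Lemma wprob_ge0 (R : realType) (a : R) n (w : {ffun 'I_n -> nat}) :
  1 < a -> 0 <= wprob a w.
Proof. by move=> a1; rewrite prodr_ge0// => i _; rewrite zipf_pmf_ge0. Qed.

Lemma wprob_eq0 (R : realType) (a : R) n (w : {ffun 'I_n -> nat}) i :
  w i = 0%N -> wprob a w = 0.
Proof. by move=> wi0; rewrite /wprob (bigD1 i)//= wi0 /zipf_pmf ltnn mul0r. Qed.

Lemma wprob_sum1 (R : realType) (a : R) n : 1 < a ->
  (\esum_(w in [set: {ffun 'I_n -> nat}]) (wprob a w)%:E = 1%:E)%E.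
Proof.
move=> a1; rewrite (@esum_ffun_prod _ _ n (fun=> zipf_pmf a) (fun=> 1)).
- by rewrite big1.
- by move=> _ k; rewrite zipf_pmf_ge0.
- by move=> _; rewrite zipf_pmf_sum1.
Qed.

Lemma wprob_mean_sum (R : realType) (a : R) n : 1 < a ->
  zipf_mean a \is a fin_num ->
  (\esum_(w in [set: {ffun 'I_n -> nat}]) (wprob a w * \sum_(i < n) (w i)%:R)%:E =
   (n%:R * fine (zipf_mean a))%:E)%E.
Proof.
move=> a1 mean_fin.
(* Linearity of expectation: absorbing the value [w i] into the [i]-th factor keeps each summand a
   product, so [esum_ffun_prod] applies. *)
pose g i (j : 'I_n) k := if j == i then k%:R * zipf_pmf a k else zipf_pmf a k.
have g0 i j k : 0 <= g i j k by rewrite /g; case: ifP; rewrite ?mulr_ge0 ?zipf_pmf_ge0.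
have gE (i : 'I_n) (w : {ffun 'I_n -> nat}) : \prod_(j < n) g i j (w j) = wprob a w * (w i)%:R.
  rewrite /wprob [LHS](bigD1 i)//= [in RHS](bigD1 i)//= mulrAC [zipf_pmf _ _ * _]mulrC.
  rewrite {1}/g eqxx; congr (_ * _).
  by apply: eq_bigr => j /negPf ji; rewrite /g ji.
rewrite (eq_esum (b := fun w : {ffun 'I_n -> nat} => (\sum_(i < n) (\prod_(j < n) g i j (w j))%:E)%E)).
  rewrite esum_sum; last by move=> w i _ _; rewrite lee_fin prodr_ge0.
  rewrite (eq_bigr (fun=> (fine (zipf_mean a))%:E)).
    by rewrite sumEFin sumr_const card_ord mulr_natl.
  move=> i _; rewrite (@esum_ffun_prod _ _ n (g i)
      (fun j => if j == i then fine (zipf_mean a) else 1))//.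
    by rewrite -big_mkcond big_pred1_eq.
  by move=> j; rewrite /g; case: ifP => _; [rewrite fineK|rewrite zipf_pmf_sum1].
move=> w _; rewrite sumEFin mulr_sumr; congr EFin.
by apply: eq_bigr => i _; rewrite gE.
Qed.

(** * Binomial means, and counting by distinct values *)

(** Absorption, [k * 'C(m.+1, k) = m.+1 * 'C(m, k.-1)], leaves the binomial expansion of
    [((1 - p) + p) ^+ m = 1]. *)
Lemma binom_meanE (R : realType) (m : nat) (p : R) : binom_mean m p = m%:R * p.
Proof.
case: m => [|m]; first by rewrite /binom_mean big_ord1 !mul0r.
rewrite /binom_mean big_ord_recl mul0r add0r.
have term (k : 'I_m.+1) :
    (lift ord0 k)%:R * ('C(m.+1, lift ord0 k)%:R * p ^+ lift ord0 k *
      (1 - p) ^+ (m.+1 - lift ord0 k)) =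
    m.+1%:R * p * (((1 - p) ^+ (m - k) * p ^+ k) *+ 'C(m, k)) :> R.
  rewrite lift0 subSS !mulrA -natrM -mul_bin_diag natrM exprS -mulr_natl.
  by ring.
rewrite (eq_bigr _ (fun k _ => term k)) -mulr_sumr -exprDn.
by rewrite subrK expr1n mulr1.
Qed.

(* Counts each pair [(x, y)] once under [y <= x] or [x <= y]; at most [x]
   positive integers of [t] are [<= x]. *)
Lemma size_mul_uniq_le (s t : seq nat) : uniq s -> uniq t ->
  0%N \notin s -> 0%N \notin t ->
  (size s * size t <= \sum_(x <- s) x + \sum_(y <- t) y)%N.
Proof.
move=> us ut s0 t0.
have count_le (u : seq nat) x : uniq u -> 0%N \notin u ->
    (count (leq^~ x) u <= x)%N.
  move=> uu u0; rewrite -size_filter -[leqRHS](size_iota 1 x).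
  apply: uniq_leq_size => [|y]; first exact: filter_uniq.
  rewrite mem_filter mem_iota add1n ltnS => /andP[-> yu]; rewrite andbT lt0n.
  by apply: contraNneq u0 => <-.
have -> : (size s * size t = \sum_(x <- s) \sum_(y <- t) 1)%N.
  by rewrite -!sum1_size big_distrlr.
have pair_le : (\sum_(x <- s) \sum_(y <- t) 1 <=
    \sum_(x <- s) \sum_(y <- t) (y <= x) + \sum_(x <- s) \sum_(y <- t) (x <= y))%N.
  rewrite -big_split/=; apply: leq_sum => x _; rewrite -big_split/=.
  by apply: leq_sum => y _; have [->|->] := orP (leq_total x y); rewrite ?addn1 ?add1n.
apply: (leq_trans pair_le); rewrite [X in (_ + X <= _)%N]exchange_big.
apply: leq_add; apply: leq_sum => x _; rewrite -big_mkcond /= sum1_count;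
  exact: count_le.
Qed.

(** The set in [cls] is a classical one; this passes to a boolean predicate, ready for counting. *)
Lemma clsE n (w : {ffun 'I_n -> nat}) a : cls w a = #|[pred i | w i == a]|.
Proof. by apply: eq_card => i; rewrite !inE; apply/idP/idP; rewrite in_setE. Qed.

(** The classes of equal weight partition the indices, so exchanging the two sums leaves exactly one
    value [a = w i] for each [i]. *)
Lemma sum_dvals (R : pzSemiRingType) n (w : {ffun 'I_n -> nat}) (F : nat -> R) :
  \sum_(a <- dvals w) (cls w a)%:R * F a = \sum_(i < n) F (w i).
Proof.
have term a : (cls w a)%:R * F a = \sum_(i < n | w i == a) F a.
  by rewrite sumr_const mulr_natl clsE.
under eq_bigr do rewrite term.
rewrite (exchange_big_dep predT)//=; apply: eq_bigr => i _.
rewrite (eq_bigl (pred1 (w i))) => [|a]; last by rewrite /= eq_sym.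
by rewrite -big_filter filter_pred1_uniq ?undup_uniq ?mem_undup ?codom_f// big_seq1.
Qed.

(** Every listed value is attained, so its multiplicity is at least 1 in [sum_dvals]. *)
Lemma sum_dvals_le n (w : {ffun 'I_n -> nat}) :
  (\sum_(a <- dvals w) a <= \sum_(i < n) w i)%N.
Proof.

rewrite -(ler_nat int) !natr_sum -(@sum_dvals int _ w (fun a => a%:R)).
rewrite big_seq [leRHS]big_seq; apply: ler_sum => a; rewrite mem_undup => /codomP[i ->].
by rewrite ler_peMl ?ler0n// ler1n clsE; apply/card_gt0P; exists i; rewrite inE.
Qed.

(** * Bounds conditional on the weights *)

Section Conditional.
Variables (R : realType) (M : R) (nL nR : nat).
Variables (wl : {ffun 'I_nL -> nat}) (wr : {ffun 'I_nR -> nat}).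

Lemma dvals_mul_le : (forall i, 0 < wl i)%N -> (forall i, 0 < wr i)%N ->
  (size (dvals wl) * size (dvals wr) <= \sum_(i < nL) wl i + \sum_(i < nR) wr i)%N.
Proof.
have dvals_gt0 n (w : {ffun 'I_n -> nat}) : (forall i, 0 < w i)%N -> 0%N \notin dvals w.
  by move=> w0; rewrite mem_undup; apply/codomP => -[i wi]; have := w0 i; rewrite -wi.
move=> wl0 wr0; apply: (leq_trans (size_mul_uniq_le _ _ _ _ _ _));
  rewrite ?undup_uniq ?dvals_gt0//.
by rewrite leq_add// sum_dvals_le.
Qed.

Let cond_edgesE : cond_edges M wl wr =
  \sum_(a <- dvals wl) \sum_(b <- dvals wr)
    (cls wl a)%:R * (cls wr b)%:R * Num.min 1 (a%:R * b%:R / (nR%:R * M)).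
Proof.
by apply: eq_bigr => a _; apply: eq_bigr => b _; rewrite binom_meanE natrM.
Qed.

(** Bounding the truncated probability by its second argument makes the double sum factor, and
    [sum_dvals] evaluates both factors. *)
Lemma cond_edges_le : cond_edges M wl wr <=
  (\sum_(i < nL) (wl i)%:R) * (\sum_(i < nR) (wr i)%:R) / (nR%:R * M).
Proof.
rewrite cond_edgesE -(@sum_dvals _ _ wl (fun a => a%:R)) -(@sum_dvals _ _ wr (fun a => a%:R)).
rewrite big_distrlr/= mulr_suml; apply: ler_sum => a _; rewrite mulr_suml.
apply: ler_sum => b _.
rewrite [leRHS](_ : _ = (cls wl a)%:R * (cls wr b)%:R * (a%:R * b%:R / (nR%:R * M))).
  by rewrite ler_wpM2l ?mulr_ge0// ge_min lexx orbT.
by rewrite mulrACA !mulrA.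
Qed.

(** As [a, b >= 1] and [nR * M >= 1], each truncated probability is at least [1 / (nR * M)]; the
    products of class sizes add up to [nL * nR]. *)
Lemma cond_edges_ge : (forall i, 0 < wl i)%N -> (forall i, 0 < wr i)%N ->
  1 <= nR%:R * M -> nL%:R * nR%:R / (nR%:R * M) <= cond_edges M wl wr.
Proof.
move=> wl0 wr0 M1.
have sum_cls n (w : {ffun 'I_n -> nat}) : n%:R = \sum_(a <- dvals w) (cls w a)%:R :> R.
  rewrite -(eq_bigr _ (fun a _ => mulr1 _)) (@sum_dvals _ _ w (fun=> 1)).
  by rewrite sumr_const card_ord.
have M0 : 0 < nR%:R * M by exact: lt_le_trans M1.
rewrite cond_edgesE (sum_cls _ wl) [X in _ * X / _](sum_cls _ wr).
rewrite big_distrlr/= mulr_suml big_seq [leRHS]big_seq; apply: ler_sum => a.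
rewrite mem_undup => /codomP[i ->]; rewrite mulr_suml big_seq [leRHS]big_seq.
apply: ler_sum => b; rewrite mem_undup => /codomP[j ->]; rewrite ler_wpM2l ?mulr_ge0//.
rewrite le_min invf_le1// M1/= -[leLHS]mul1r ler_wpM2r ?invr_ge0 ?(ltW M0)//.
by rewrite -natrM ler1n muln_gt0 wl0 wr0.
Qed.

Lemma cond_time_le : (forall i, 0 < wl i)%N -> (forall i, 0 < wr i)%N ->
  cond_time M wl wr <= (nL%:R + nR%:R) +
    (\sum_(i < nL) (wl i)%:R + \sum_(i < nR) (wr i)%:R) +
  (\sum_(i < nL) (wl i)%:R) * (\sum_(i < nR) (wr i)%:R) / (nR%:R * M).
Proof.
move=> wl0 wr0; rewrite lerD ?cond_edges_le// !natrD lerD2l.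
by rewrite -!natr_sum -natrD ler_nat dvals_mul_le.
Qed.

End Conditional.

(** * Expected time and expected number of edges *)

Section Expectation.
Variables (R : realType) (aL aR : R).
Hypotheses (aL_gt1 : 1 < aL) (aR_gt1 : 1 < aR).
Hypotheses (muL_fin : zipf_mean aL \is a fin_num) (muR_fin : zipf_mean aR \is a fin_num).
Let muL := fine (zipf_mean aL).
Let muR := fine (zipf_mean aR).

Let muL_ge1 : 1 <= muL. Proof. exact: zipf_mean_ge1. Qed.
Let muR_ge1 : 1 <= muR. Proof. exact: zipf_mean_ge1. Qed.

(* A vanishing weight has probability 0, so only positive weights matter. *)
Lemma expect_over_le (nL nR : nat)
    (f g : {ffun 'I_nL -> nat} -> {ffun 'I_nR -> nat} -> R) :
  (forall (wl : {ffun 'I_nL -> nat}) (wr : {ffun 'I_nR -> nat}),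
    (forall i, 0 < wl i)%N -> (forall i, 0 < wr i)%N -> f wl wr <= g wl wr) ->
  (expect_over aL aR f <= expect_over aL aR g)%E.
Proof.
move=> fg; apply: le_esum => -[wl wr] _; rewrite lee_fin /=.
have [/forallP wl0|/forallPn[i]] := boolP [forall i, (0 < wl i)%N]; last first.
  by rewrite -eqn0Ngt => /eqP /(wprob_eq0 R aL) ->; rewrite !mul0r.
have [/forallP wr0|/forallPn[i]] := boolP [forall i, (0 < wr i)%N]; last first.
  by rewrite -eqn0Ngt => /eqP /(wprob_eq0 R aR) ->; rewrite !mulr0 !mul0r.
by rewrite ler_wpM2l ?fg// mulr_ge0 ?wprob_ge0.
Qed.

(** Independence of the left and right weights. *)
Let expect_over_prod (nL nR : nat) (f : {ffun 'I_nL -> nat} -> R)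
    (g : {ffun 'I_nR -> nat} -> R) (s t : R) :
  (forall w, 0 <= f w) -> (forall w, 0 <= g w) ->
  (\esum_(w in [set: {ffun 'I_nL -> nat}]) (wprob aL w * f w)%:E = s%:E)%E ->
  (\esum_(w in [set: {ffun 'I_nR -> nat}]) (wprob aR w * g w)%:E = t%:E)%E ->
  expect_over aL aR (fun wl wr => f wl * g wr) = (s * t)%:E.
Proof.
move=> f0 g0 fs gt; rewrite -(@esum_prod R _ _ (fun w => wprob aL w * f w)
  (fun w => wprob aR w * g w) s t)//.
- by apply: eq_esum => w _; rewrite mulrACA.
- by move=> w; rewrite mulr_ge0 ?wprob_ge0.
- by move=> w; rewrite mulr_ge0 ?wprob_ge0.
Qed.

Let expect_over_cst (nL nR : nat) (c : R) : 0 <= c ->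
  @expect_over R aL aR nL nR (fun _ _ => c) = c%:E.
Proof.
move=> c0; rewrite -[in RHS](mulr1 c) -(@expect_over_prod nL nR (fun=> c) (fun=> 1) c 1)//.
- by congr expect_over; apply/funext => wl; apply/funext => wr; rewrite mulr1.
- rewrite (eq_esum (b := fun w : {ffun 'I_nL -> nat} => (c%:E * (wprob aL w)%:E)%E)).
    by rewrite ge0_esumZl// ?wprob_sum1 ?mule1// => w; rewrite lee_fin wprob_ge0.
  by move=> w _; rewrite mulrC EFinM.
- by rewrite -(wprob_sum1 R aR nR aR_gt1); apply: eq_esum => w _; rewrite mulr1.
Qed.

Lemma expect_overD (nL nR : nat)
    (f g : {ffun 'I_nL -> nat} -> {ffun 'I_nR -> nat} -> R) :
  (forall wl wr, 0 <= f wl wr) -> (forall wl wr, 0 <= g wl wr) ->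
  (expect_over aL aR (fun wl wr => f wl wr + g wl wr)%R =
   expect_over aL aR f + expect_over aL aR g)%E.
Proof.
move=> f0 g0; rewrite /expect_over -esumD; last 2 first.
- by move=> w _; rewrite lee_fin !mulr_ge0 ?wprob_ge0.
- by move=> w _; rewrite lee_fin !mulr_ge0 ?wprob_ge0.
by apply: eq_esum => w _; rewrite mulrDr EFinD.
Qed.

Lemma expected_time_le (nL nR : nat) : (0 < nR)%N ->
  nL%:R * muL = nR%:R * muR ->
  (expected_time aL aR nL nR <= (5 * (muL * nL%:R))%:E)%E.
Proof.
(* [M] names the common value in [balance]; it dominates [nL] and [nR] because both means are at
   least 1. *)
move=> nR0 balance; have [M ME] : exists M, M = nR%:R * muR by eexists.
have nRM : nR%:R <= M by rewrite ME ler_peMr.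
have M0 : 0 < M by apply: lt_le_trans nRM; rewrite ltr0n; exact: nR0.
have nLM : nL%:R <= M by rewrite ME -balance ler_peMr.
have ML : M = muL * nL%:R by rewrite ME -balance mulrC.
pose S n (w : {ffun 'I_n -> nat}) : R := \sum_(i < n) (w i)%:R.
have S0 n w : 0 <= S n w by rewrite sumr_ge0.
have one_sum a n : 1 < a ->
    (\esum_(w in [set: {ffun 'I_n -> nat}]) (wprob a w * 1)%:E = 1%:E :> \bar R)%E.
  by move=> a1; rewrite -(wprob_sum1 R a n a1); apply: eq_esum => w _; rewrite mulr1.
(* The factors 1 here and in [ER] put the one-sided sums into the product form of
   [expect_over_prod]. *)
have EL : expect_over aL aR (fun wl (_ : {ffun 'I_nR -> nat}) => S nL wl * 1) = M%:E.
  rewrite -[M]mulr1; apply: (@expect_over_prod nL nR (S nL) (fun=> 1)).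
  - exact: S0.
  - by move=> w; exact: ler01.
  - by rewrite ME -balance; exact: wprob_mean_sum.
  - exact: one_sum.
have ER : expect_over aL aR (fun (_ : {ffun 'I_nL -> nat}) wr => 1 * S nR wr) = M%:E.
  rewrite -[M]mul1r; apply: (@expect_over_prod nL nR (fun=> 1) (S nR)).
  - by move=> w; exact: ler01.
  - exact: S0.
  - exact: one_sum.
  - by rewrite ME; exact: wprob_mean_sum.
(* Dividing the right factor by [M] gives it expectation 1, so the product has expectation [M]. *)
have ELR : expect_over aL aR (fun wl wr => S nL wl * (S nR wr / M)) = (M * 1)%:E.
  apply: (@expect_over_prod nL nR (S nL) (fun wr => S nR wr / M)).
  - exact: S0.
  - by move=> w; exact: divr_ge0 (S0 _ _) (ltW M0).
  - by rewrite ME -balance; exact: wprob_mean_sum.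
  rewrite (eq_esum (b := fun w : {ffun 'I_nR -> nat} => (M^-1%:E * (wprob aR w * S nR w)%:E)%E)).
    rewrite ge0_esumZl; first last.
    - by move=> w; rewrite lee_fin mulr_ge0 ?wprob_ge0.
    - by rewrite invr_ge0 ltW.
    by rewrite (wprob_mean_sum _ _ _ aR_gt1 muR_fin) -EFinM -/muR -ME mulVf ?gt_eqF.
  by move=> w _; rewrite -EFinM; congr EFin; rewrite mulrA mulrC.
(* The constant 5 counts the summands, each of expectation at most [M]: [nL], [nR], the two weight
   sums and their product over [M]. *)
apply: (@le_trans _ _ (expect_over aL aR (fun wl wr =>
  (nL%:R + nR%:R) + (S nL wl * 1 + (1 * S nR wr + S nL wl * (S nR wr / M)))))).
  apply: expect_over_le => wl wr wl0 wr0; apply: le_trans (cond_time_le _ _ _ _ _ _ wl0 wr0) _.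
  by rewrite -/(S nL wl) -/(S nR wr) -/muR -ME mulr1 mul1r !addrA mulrA.
rewrite !expect_overD; first last; do ?by move=> wl wr; rewrite ?addr_ge0 ?mulr_ge0 ?invr_ge0 ?(ltW M0).
rewrite (expect_over_cst _ _ _ (ler0n _ nL)) (expect_over_cst _ _ _ (ler0n _ nR)) EL ER ELR mulr1.
rewrite -!EFinD lee_fin -ML; lra.
Qed.

(** The bound of [cond_edges_ge] simplifies to the constant [nL / muR], whose expectation is
    itself. *)
Lemma expected_edges_ge (nL nR : nat) : (0 < nR)%N ->
  ((nL%:R / muR)%:E <= expected_edges aL aR nL nR)%E.
Proof.
move=> nR0; have muR0 : 0 < muR by exact: lt_le_trans muR_ge1.
rewrite -(@expect_over_cst nL nR); last by rewrite divr_ge0 ?(ltW muR0).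
apply: expect_over_le => wl wr wl0 wr0.
apply: le_trans (cond_edges_ge _ _ _ _ _ _ wl0 wr0 _); last first.
  by rewrite (le_trans muR_ge1)// ler_peMl ?ler1n ?(ltW muR0).
by rewrite invfM mulrA mulfK// pnatr_eq0 -lt0n.
Qed.

End Expectation.

(** * The running time bound and its optimality *)

Theorem mainTheorem13 (R : realType) (aL aR : R) :
  1 < aL -> 1 < aR ->
  zipf_mean aL \is a fin_num -> zipf_mean aR \is a fin_num ->
  (exists C : R, 0 < C /\
     forall nL nR : nat, (0 < nL)%N -> (0 < nR)%N ->
       nL%:R * fine (zipf_mean aL) = nR%:R * fine (zipf_mean aR) ->
       (expected_time aL aR nL nR <=
        (C * (nL%:R `^ (1 / (aL - 1)) * nR%:R `^ (1 / (aR - 1))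
              + fine (zipf_mean aL) * nL%:R))%:E)%E)
  /\
  (3 < aL -> 3 < aR ->
   exists C : R, 0 < C /\
     forall nL nR : nat, (0 < nL)%N -> (0 < nR)%N ->
       nL%:R * fine (zipf_mean aL) = nR%:R * fine (zipf_mean aR) ->
       (expected_time aL aR nL nR <= C%:E * expected_edges aL aR nL nR)%E).
Proof.
move=> aL1 aR1 muL_fin muR_fin.
have muL0 : 0 < fine (zipf_mean aL) by exact: lt_le_trans (zipf_mean_ge1 _ _ aL1 muL_fin).
have muR0 : 0 < fine (zipf_mean aR) by exact: lt_le_trans (zipf_mean_ge1 _ _ aR1 muR_fin).
split=> [|_ _].
  exists 5; split=> [|nL nR nL0 nR0 balance]; first by rewrite ltr0n.
  apply: (le_trans (expected_time_le _ _ _ aL1 aR1 muL_fin muR_fin _ _ nR0 balance)).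
  (* The product of powers is nonnegative, so adding it only enlarges the bound. *)
  by rewrite lee_fin ler_wpM2l ?ler0n ?lerDr ?mulr_ge0 ?powR_ge0.
(* This constant is the ratio of the upper bound [5 * muL * nL] on the time to the lower bound
   [nL / muR] on the edges. *)
have C_gt0 : 0 < 5 * fine (zipf_mean aL) * fine (zipf_mean aR).
  have five_gt0 : 0 < 5 :> R by rewrite ltr0n.
  exact: mulr_gt0 (mulr_gt0 five_gt0 muL0) muR0.
exists (5 * fine (zipf_mean aL) * fine (zipf_mean aR)); split=> [|nL nR nL0 nR0 balance].
  exact: C_gt0.
apply: (le_trans (expected_time_le _ _ _ aL1 aR1 muL_fin muR_fin _ _ nR0 balance)).
have edges_ge := expected_edges_ge _ _ _ aL1 aR1 muR_fin nL _ nR0.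
apply: le_trans (lee_wpmul2l _ edges_ge); last by rewrite lee_fin ltW.
have cancel_mu (c l r n : R) : r != 0 -> c * (l * n) = c * l * r * (n / r).
  by move=> r0; field.
rewrite (cancel_mu 5 _ _ _ (lt0r_neq0 muR0)) EFinM; exact: lexx.
Qed.
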